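(* For any groups $G$ and $H$, there is a natural continuous epimorphism of profinite groups $\mathcal{K}_{G\ast H}\to\mathcal{K}_G$, where $G\ast H$ is the free product.
   Context: For a profinite group $\mathcal{H}$, a continuous epimorphism $f:\mathcal{G}\to\mathcal{H}$ of profinite groups is a Frattini cover if for every closed subgroup $\mathcal{G}_0\leqslant\mathcal{G}$, $\mathcal{G}_0=\mathcal{G}$ iff $f(\mathcal{G}_0)=\mathcal{H}$; it is a universal Frattini cover if moreover $\mathcal{G}$ is projective. It is unique up to isomorphism over $\mathcal{H}$; its domain is denoted $\widetilde{\mathcal{H}}$. Set $\mathcal{K}_{\mathcal{H}}:=\ker(\widetilde{\mathcal{H}}\to\mathcal{H})$, and for an abstract group $G$ let $\mathcal{K}_G:=\mathcal{K}_{\widehat{G}}$, where $\widehat{G}$ is the profinite completion of $G$. *)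

(* Defs.v *)
From HB Require Import structures.
From mathcomp Require Import all_boot.
From mathcomp Require Import all_classical topology function_spaces.
From mathcomp Require Import separation_axioms.

Set Implicit Arguments.
Unset Strict Implicit.
Unset Printing Implicit Defensive.

Local Open Scope classical_set_scope.
Local Open Scope quotient_scope.
Local Open Scope group_scope.

Definition subgroup (G : groupType) (A : set G) :=
  [/\ A 1, forall x y, A x -> A y -> A (x * y) & forall x, A x -> A x^-1].

Lemma hom1 (A B : groupType) (h : {multiplicative A -> B}) : h 1 = 1.
Proof. by apply: (mulgI (h 1)); rewrite -gmulfM !mulg1. Qed.

Lemma homV (A B : groupType) (h : {multiplicative A -> B}) x :
  h x^-1 = (h x)^-1.
Proof. by apply: (mulgI (h x)); rewrite -gmulfM !mulgV hom1. Qed.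

Section FreeProduct.
Variables G H : groupType.

Inductive fp_equiv : seq (G + H) -> seq (G + H) -> Prop :=
| fp_refl w : fp_equiv w w
| fp_sym w w' : fp_equiv w w' -> fp_equiv w' w
| fp_trans w1 w2 w3 : fp_equiv w1 w2 -> fp_equiv w2 w3 -> fp_equiv w1 w3
| fp_cat v v' w w' :
    fp_equiv v v' -> fp_equiv w w' -> fp_equiv (v ++ w) (v' ++ w')
| fp_mull (x y : G) : fp_equiv [:: inl x; inl y] [:: inl (x * y)]
| fp_mulr (x y : H) : fp_equiv [:: inr x; inr y] [:: inr (x * y)]
| fp_onel : fp_equiv [:: inl 1] [::]
| fp_oner : fp_equiv [:: inr 1] [::].

Definition fp_rel (v w : seq (G + H)) : bool := `[< fp_equiv v w >].

Lemma fp_rel_equiv : equiv_class_of fp_rel.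
Proof.
split=> [w|v w|w v1 v2].
- exact/asboolP/fp_refl.
- by apply/asboolP/asboolP; exact: fp_sym.
- by move=> /asboolP vw /asboolP wu; apply/asboolP; apply: fp_trans vw wu.
Qed.

Canonical fp_rel_equiv_rel := EquivRelPack fp_rel_equiv.

Definition free_product : Type := {eq_quot fp_rel}.

HB.instance Definition _ := Choice.on free_product.

Definition fp_class (w : seq (G + H)) : free_product := \pi_({eq_quot fp_rel}) w.
Definition fp_word (x : free_product) : seq (G + H) :=
  repr (x : {eq_quot fp_rel}).

Lemma fp_wordK x : fp_class (fp_word x) = x.
Proof. exact: reprK. Qed.

Lemma fp_classP v w : fp_class v = fp_class w <-> fp_equiv v w.
Proof.
by split=> [/eqmodP/asboolP//|vw]; apply/eqmodP/asboolP.
Qed.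

Lemma fp_word_class w : fp_equiv (fp_word (fp_class w)) w.
Proof. by apply/fp_classP; rewrite fp_wordK. Qed.

Definition fp_letter_inv (a : G + H) : G + H :=
  match a with inl x => inl x^-1 | inr y => inr y^-1 end.
Definition fp_word_inv (w : seq (G + H)) := rev (map fp_letter_inv w).

Definition fp_one : free_product := fp_class [::].
Definition fp_mul (x y : free_product) := fp_class (fp_word x ++ fp_word y).
Definition fp_inv (x : free_product) := fp_class (fp_word_inv (fp_word x)).

Lemma fp_mul_class v w : fp_mul (fp_class v) (fp_class w) = fp_class (v ++ w).
Proof. by apply/fp_classP/fp_cat; exact: fp_word_class. Qed.

Lemma fp_mulA : associative fp_mul.
Proof.
move=> x y z; rewrite -[x]fp_wordK -[y]fp_wordK -[z]fp_wordK.
by rewrite !fp_mul_class catA.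
Qed.

Lemma fp_mul1 : left_id fp_one fp_mul.
Proof. by move=> x; rewrite -[x]fp_wordK fp_mul_class. Qed.

Lemma fp_mulr1 : right_id fp_one fp_mul.
Proof. by move=> x; rewrite -[x]fp_wordK fp_mul_class cats0. Qed.

Lemma fp_letterV (a : G + H) : fp_equiv [:: fp_letter_inv a; a] [::].
Proof.
case: a => x /=.
  by apply: fp_trans (fp_mull _ _) _; rewrite mulVg; exact: fp_onel.
by apply: fp_trans (fp_mulr _ _) _; rewrite mulVg; exact: fp_oner.
Qed.

Lemma fp_word_invV w : fp_equiv (fp_word_inv w ++ w) [::].
Proof.
elim: w => [|a w IH]; first exact: fp_refl.
rewrite /fp_word_inv /= rev_cons cat_rcons -[_ :: _ :: w]/([:: _; a] ++ w).
apply: fp_trans IH; apply: fp_cat; first exact: fp_refl.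
by rewrite -[X in fp_equiv _ X]cat0s; apply: fp_cat;
  [exact: fp_letterV|exact: fp_refl].
Qed.

Lemma fp_letter_invK : involutive fp_letter_inv.
Proof. by case=> x /=; rewrite invgK. Qed.

Lemma fp_word_invK : involutive fp_word_inv.
Proof.
by move=> w; rewrite /fp_word_inv map_rev revK mapK//; exact: fp_letter_invK.
Qed.

Lemma fp_mulV : left_inverse fp_one fp_inv fp_mul.
Proof.
move=> x; rewrite -[in X in fp_mul _ X](fp_wordK x) fp_mul_class.
exact/fp_classP/fp_word_invV.
Qed.

Lemma fp_mulrV : right_inverse fp_one fp_inv fp_mul.
Proof.
move=> x; rewrite -[X in fp_mul X _](fp_wordK x) fp_mul_class.
by apply/fp_classP; rewrite -{1}[fp_word x]fp_word_invK; exact: fp_word_invV.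
Qed.

HB.instance Definition _ := isGroup.Build free_product
  fp_mulA fp_mul1 fp_mulr1 fp_mulV fp_mulrV.

Definition fp_inl (x : G) : free_product := fp_class [:: inl x].
Definition fp_inr (y : H) : free_product := fp_class [:: inr y].

Lemma fp_inl_is_multiplicative : {morph fp_inl : x y / x * y}.
Proof.
by move=> x y; rewrite [RHS]fp_mul_class; apply/fp_classP/fp_sym/fp_mull.
Qed.
HB.instance Definition _ :=
  isMultiplicative.Build G free_product fp_inl fp_inl_is_multiplicative.

Lemma fp_inr_is_multiplicative : {morph fp_inr : x y / x * y}.
Proof.
by move=> x y; rewrite [RHS]fp_mul_class; apply/fp_classP/fp_sym/fp_mulr.
Qed.
HB.instance Definition _ :=
  isMultiplicative.Build H free_product fp_inr fp_inr_is_multiplicative.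

Section Lift.
Variables (K : groupType).
Variables (f : {multiplicative G -> K}) (g : {multiplicative H -> K}).

Definition fp_letter_eval (a : G + H) : K :=
  match a with inl x => f x | inr y => g y end.
Definition fp_eval (w : seq (G + H)) : K :=
  foldr (fun a k => fp_letter_eval a * k) 1 w.
Definition fp_lift (x : free_product) : K := fp_eval (fp_word x).

Lemma fp_eval_cat v w : fp_eval (v ++ w) = fp_eval v * fp_eval w.
Proof. by elim: v => [|a v IH] /=; rewrite ?mul1g// IH mulgA. Qed.

Lemma fp_eval_equiv v w : fp_equiv v w -> fp_eval v = fp_eval w.
Proof.
elim=> {v w} //=.
- by move=> ? ? ? _ -> _ ->.
- by move=> ? ? ? ? _ + _; rewrite !fp_eval_cat => -> ->.
- by move=> x y; rewrite gmulfM !mulg1.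
- by move=> x y; rewrite gmulfM !mulg1.
- by rewrite hom1 mulg1.
- by rewrite hom1 mulg1.
Qed.

Lemma fp_lift_class w : fp_lift (fp_class w) = fp_eval w.
Proof. exact/fp_eval_equiv/fp_word_class. Qed.

Lemma fp_lift_is_multiplicative : {morph fp_lift : x y / x * y}.
Proof.
move=> x y; rewrite -[x]fp_wordK -[y]fp_wordK [_ * _]fp_mul_class.
by rewrite !fp_lift_class fp_eval_cat.
Qed.
HB.instance Definition _ :=
  isMultiplicative.Build free_product K fp_lift fp_lift_is_multiplicative.

Lemma fp_lift_inl x : fp_lift (fp_inl x) = f x.
Proof. by rewrite fp_lift_class /= mulg1. Qed.

Lemma fp_lift_inr y : fp_lift (fp_inr y) = g y.
Proof. by rewrite fp_lift_class /= mulg1. Qed.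

Lemma fp_lift_unique (h : {multiplicative free_product -> K}) :
  h \o fp_inl =1 f -> h \o fp_inr =1 g -> h =1 fp_lift.
Proof.
move=> hl hr x; rewrite -[x]fp_wordK fp_lift_class.
elim: (fp_word x) => [|a w IH] /=; first exact: hom1.
rewrite -[a :: w]/([:: a] ++ w) -fp_mul_class [h _]gmulfM IH.
by case: a => z; rewrite /= -?hl -?hr.
Qed.

End Lift.

Definition fp_fst : free_product -> G := fp_lift idfun (one_fun G).
HB.instance Definition _ := Multiplicative.on fp_fst.

End FreeProduct.

HB.structure Definition PreTopologicalGroup := {G of Group G & Topological G}.

HB.mixin Record isTopologicalGroup G of PreTopologicalGroup G := {
  mulg_continuous : continuous (fun x : G * G => x.1 * x.2);
  invg_continuous : continuous (fun x : G => x^-1)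
}.

#[short(type="topGroupType")]
HB.structure Definition TopologicalGroup :=
  {G of PreTopologicalGroup G & isTopologicalGroup G}.

HB.mixin Record isProfinite G of TopologicalGroup G := {
  profinite_compact : compact [set: G];
  profinite_hausdorff : hausdorff_space G;
  profinite_totally_disconnected : totally_disconnected [set: G]
}.

#[short(type="profGroupType")]
HB.structure Definition ProfiniteGroup :=
  {G of TopologicalGroup G & isProfinite G}.

HB.structure Definition ContHom (X Y : topGroupType) :=
  {f of @isMultiplicative X Y f & @isContinuous X Y f}.

Notation "{ 'conthom' X -> Y }" := (ContHom.type X%type Y%type)
  (X at level 98, Y at level 99, format "{ 'conthom'  X  ->  Y }")
  : type_scope.


Lemma initial_continuousP (S : choiceType) (T X : topologicalType) (e : S -> T)
    (f : X -> initial_topology e) :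
  continuous ((e : initial_topology e -> T) \o f) -> continuous f.
Proof.
move=> /continuousP ef; apply/continuousP => _ [B oB <-].
by rewrite -comp_preimage; exact: ef.
Qed.

Lemma prod_continuousP (I : choiceType) (T : I -> topologicalType)
    (X : topologicalType) (f : X -> prod_topology T) :
  (forall i, continuous (fun x => f x i)) -> continuous f.
Proof.
move=> fi x; apply/cvg_sup => i.
exact: (@initial_continuousP _ _ _ (fun g : prod_topology T => g i) f (fi i)).
Qed.

Lemma pair_map_continuous (X Y : topologicalType) (f : X -> Y) :
  continuous f -> continuous (fun x : X * X => (f x.1, f x.2)).
Proof.
move=> cf x; apply: cvg_pair.
  by apply: (@continuous_comp _ _ _ fst f); [exact: cvg_fst | exact: cf].
by apply: (@continuous_comp _ _ _ snd f); [exact: cvg_snd | exact: cf].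
Qed.

Section ProductGroup.
Variables (I : choiceType) (T : I -> profGroupType).

Definition prod_group : Type := prod_topology T.

HB.instance Definition _ := Topological.on prod_group.

Let pmul (x y : prod_group) : prod_group := fun i => x i * y i.
Let pone : prod_group := fun i => 1.
Let pinv (x : prod_group) : prod_group := fun i => (x i)^-1.

Fact prod_mulA : associative pmul.
Proof. by move=> x y z; apply/functional_extensionality_dep => i; exact: mulgA. Qed.
Fact prod_mul1 : left_id pone pmul.
Proof. by move=> x; apply/functional_extensionality_dep => i; exact: mul1g. Qed.
Fact prod_mulr1 : right_id pone pmul.
Proof. by move=> x; apply/functional_extensionality_dep => i; exact: mulg1. Qed.
Fact prod_mulV : left_inverse pone pinv pmul.
Proof. by move=> x; apply/functional_extensionality_dep => i; exact: mulVg. Qed.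
Fact prod_mulrV : right_inverse pone pinv pmul.
Proof. by move=> x; apply/functional_extensionality_dep => i; exact: mulgV. Qed.

HB.instance Definition _ :=
  isGroup.Build prod_group prod_mulA prod_mul1 prod_mulr1 prod_mulV prod_mulrV.

Lemma prod_group_proj_continuous i : continuous (fun x : prod_group => x i).
Proof. exact: (@proj_continuous I T i). Qed.

Fact prod_group_mul_continuous :
  continuous (fun x : prod_group * prod_group => x.1 * x.2).
Proof.
apply: prod_continuousP => i x.
apply: (@continuous_comp _ _ _
  (fun x : prod_group * prod_group => (x.1 i, x.2 i)) (fun y => y.1 * y.2)).
  exact: (pair_map_continuous (@prod_group_proj_continuous i)).
exact: mulg_continuous.
Qed.

Fact prod_group_inv_continuous : continuous (fun x : prod_group => x^-1).
Proof.
apply: prod_continuousP => i x.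
apply: (@continuous_comp _ _ _ (fun x : prod_group => x i) (fun y => y^-1)).
  exact: prod_group_proj_continuous.
exact: invg_continuous.
Qed.

HB.instance Definition _ := isTopologicalGroup.Build prod_group
  prod_group_mul_continuous prod_group_inv_continuous.

Fact prod_group_compact : compact [set: prod_group].
Proof.
have := @tychonoff I T (fun=> setT) (fun i => @profinite_compact (T i)).
by congr compact; apply/seteqP; split.
Qed.

Fact prod_group_hausdorff : hausdorff_space prod_group.
Proof. exact: (hausdorff_product (fun i => @profinite_hausdorff (T i))). Qed.

Fact prod_group_totally_disconnected : totally_disconnected [set: prod_group].
Proof.
have := @totally_disconnected_prod I T (fun=> setT)
  (fun i => @profinite_totally_disconnected (T i)).
by congr totally_disconnected; apply/seteqP; split.
Qed.

HB.instance Definition _ := isProfinite.Build prod_group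
  prod_group_compact prod_group_hausdorff prod_group_totally_disconnected.

End ProductGroup.

Record closedSubgroup (X : topGroupType) := ClosedSubgroup {
  csubgroup_set :> set X;
  csubgroup_closed : closed csubgroup_set;
  csubgroup_subgroup : subgroup csubgroup_set
}.

Section ClosedSubgroup.
Variables (X : profGroupType) (A : closedSubgroup X).

Definition csubgroup_type : Type := set_type A.

HB.instance Definition _ := Topological.on csubgroup_type.
HB.instance Definition _ := SubType.on csubgroup_type.
HB.instance Definition _ := SubChoice.on csubgroup_type.

Fact csubgroup_group_closed : group_closed (fun x : X => x \in (A : set X)).
Proof.
have [A1 AM AV] := csubgroup_subgroup A; split; first exact/mem_set.
by move=> x y /set_mem Ax /set_mem Ay; apply/mem_set/AM => //; exact: AV.
Qed.

HB.instance Definition _ := SubChoice_isSubGroup.Build X _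
  csubgroup_type csubgroup_group_closed.

Definition csubgroup_val (x : csubgroup_type) : X := val x.

Lemma csubgroup_val_continuous : continuous csubgroup_val.
Proof. exact: (@initial_continuous (set_type A) X set_val). Qed.

Lemma csubgroup_val_multiplicative : {morph csubgroup_val : x y / x * y}.
Proof. exact: valM. Qed.

HB.instance Definition _ := isMultiplicative.Build csubgroup_type X csubgroup_val
  csubgroup_val_multiplicative.

Lemma csubgroup_continuousP (Z : topologicalType) (f : Z -> csubgroup_type) :
  continuous (csubgroup_val \o f) -> continuous f.
Proof. exact: (@initial_continuousP (set_type A) X Z set_val f). Qed.

Fact csubgroup_mul_continuous :
  continuous (fun x : csubgroup_type * csubgroup_type => x.1 * x.2).
Proof.
apply: csubgroup_continuousP => x.
rewrite (_ : _ \o _ = (fun y : X * X => y.1 * y.2) \o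
  (fun x : csubgroup_type * csubgroup_type =>
    (csubgroup_val x.1, csubgroup_val x.2))); last first.
  by apply/funext => y /=; rewrite gmulfM.
apply: continuous_comp; last exact: mulg_continuous.
exact: (pair_map_continuous csubgroup_val_continuous).
Qed.

Fact csubgroup_inv_continuous : continuous (fun x : csubgroup_type => x^-1).
Proof.
apply: csubgroup_continuousP => x.
rewrite (_ : _ \o _ = (fun y : X => y^-1) \o csubgroup_val).
  by apply: continuous_comp;
    [exact: csubgroup_val_continuous | exact: invg_continuous].
apply/funext => y /=; apply: (mulgI (csubgroup_val y)).
by rewrite -gmulfM !mulgV; exact: val1.
Qed.

HB.instance Definition _ := isTopologicalGroup.Build csubgroup_type
  csubgroup_mul_continuous csubgroup_inv_continuous.

HB.instance Definition _ := isContinuous.Build csubgroup_type X csubgroup_val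
  csubgroup_val_continuous.

Definition csubgroup_mk (x : X) (Ax : csubgroup_set A x) : csubgroup_type :=
  exist _ x (mem_set Ax).

Lemma csubgroup_valP (x : csubgroup_type) : csubgroup_set A (csubgroup_val x).
Proof. exact: set_mem (valP x). Qed.

Lemma csubgroup_val_inj : injective csubgroup_val.
Proof. exact: val_inj. Qed.

Fact csubgroup_compact : compact [set: csubgroup_type].
Proof.
have cA : compact (csubgroup_set A).
  apply: (@subclosed_compact X (csubgroup_set A) setT) => //.
  - exact: csubgroup_closed.
  - exact: profinite_compact.
move=> F PF _; have FA : (csubgroup_val @ F) (csubgroup_set A).
  apply: (@filterS _ F _ setT); last exact: filterT.
  by move=> x _; exact: csubgroup_valP.
have [a [Aa Fa]] := cA (csubgroup_val @ F) _ FA.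
exists (csubgroup_mk Aa); split=> // B U FB [_ [[W oW <-] Wa WU]].
have [||_ [[b Bb <-] Wb]] := Fa (csubgroup_val @` B) W.
- apply: (@filterS _ F _ B) => //.
  by move=> b Bb; exists b.
- exact: open_nbhs_nbhs.
- by exists b; split=> //; exact: WU.
Qed.

Fact csubgroup_hausdorff : hausdorff_space csubgroup_type.
Proof.
move=> p q pq; apply/csubgroup_val_inj/profinite_hausdorff => U V pU qV.
have pU' : nbhs p (csubgroup_val @^-1` U) by exact: csubgroup_val_continuous.
have qV' : nbhs q (csubgroup_val @^-1` V) by exact: csubgroup_val_continuous.
have [z [Uz Vz]] := pq _ _ pU' qV'.
by exists (csubgroup_val z).
Qed.

Fact csubgroup_totally_disconnected : totally_disconnected [set: csubgroup_type].
Proof.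
move=> x _; apply/seteqP; split=> [y [R [Rx _ cR] Ry]|_ ->]; last first.
  exact: connected_component_refl.
apply: csubgroup_val_inj.
have valx := @profinite_totally_disconnected X (csubgroup_val x) I.
suff : connected_component setT (csubgroup_val x) (csubgroup_val y).
  by rewrite valx.
exists (csubgroup_val @` R); last by exists y.
split; [by exists x | by [] | ].
apply: connected_continuous_connected => //.
exact/continuous_subspaceT/csubgroup_val_continuous.
Qed.

HB.instance Definition _ := isProfinite.Build csubgroup_type
  csubgroup_compact csubgroup_hausdorff csubgroup_totally_disconnected.

End ClosedSubgroup.

Section Quotient.
Variable G : groupType.

Definition finite_index (N : set G) :=
  finite_set (range (fun x => [set y | N (x^-1 * y)])).

Record finIndexNormal := FinIndexNormal {
  fin_set :> set G;
  fin_subgroup : subgroup fin_set;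
  fin_normal : forall x y, fin_set x -> fin_set (x ^ y);
  fin_finite_index : finite_index fin_set
}.

HB.instance Definition _ := gen_eqMixin finIndexNormal.
HB.instance Definition _ := gen_choiceMixin finIndexNormal.

Variable N : finIndexNormal.

Definition coset_rel (x y : G) : bool := `[< fin_set N (x^-1 * y) >].

Lemma coset_rel_equiv : equiv_class_of coset_rel.
Proof.
have [N1 NM NV] := fin_subgroup N.
have relC x y : fin_set N (x^-1 * y) -> fin_set N (y^-1 * x).
  by move=> /NV; rewrite invgM invgK.
split=> [x|x y|y x z].
- by apply/asboolP; rewrite mulVg.
- by apply/asboolP/asboolP; exact: relC.
- move=> /asboolP xy /asboolP yz; apply/asboolP.
  by have := NM _ _ xy yz; rewrite mulgA mulgK.
Qed.

Canonical coset_rel_equiv_rel := EquivRelPack coset_rel_equiv.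

Definition quotg : Type := {eq_quot coset_rel}.

HB.instance Definition _ := Choice.on quotg.

Definition cosetg (x : G) : quotg := \pi_({eq_quot coset_rel}) x.
Definition cosetg_repr (q : quotg) : G := repr (q : {eq_quot coset_rel}).

Lemma cosetg_reprK q : cosetg (cosetg_repr q) = q.
Proof. exact: reprK. Qed.

Lemma cosetgP x y : cosetg x = cosetg y <-> fin_set N (x^-1 * y).
Proof. by split=> [/eqmodP/asboolP//|xy]; apply/eqmodP/asboolP. Qed.

Definition quotg_mul (p q : quotg) := cosetg (cosetg_repr p * cosetg_repr q).
Definition quotg_inv (p : quotg) := cosetg (cosetg_repr p)^-1.

Lemma quotg_mul_coset x y : quotg_mul (cosetg x) (cosetg y) = cosetg (x * y).
Proof.
have [N1 NM NV] := fin_subgroup N.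
have /cosetgP xx := cosetg_reprK (cosetg x).
have /cosetgP yy := cosetg_reprK (cosetg y).
apply/cosetgP; set x' := cosetg_repr _ in xx *; set y' := cosetg_repr _ in yy *.
have -> : (x' * y')^-1 * (x * y) = (y'^-1 * y) * ((x'^-1 * x) ^ y).
  by rewrite invgM /conjg !mulgA mulgK.
by apply: NM => //; exact: fin_normal.
Qed.

Lemma quotg_inv_coset x : quotg_inv (cosetg x) = cosetg x^-1.
Proof.
have [N1 NM NV] := fin_subgroup N.
have /esym/cosetgP xx := cosetg_reprK (cosetg x).
apply/cosetgP; set x' := cosetg_repr _ in xx *.
have -> : x'^-1^-1 * x^-1 = (x^-1 * x') ^ x^-1.
  by rewrite /conjg !invgK !mulgA mulgV mul1g.
exact: fin_normal.
Qed.

Fact quotg_mulA : associative quotg_mul.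
Proof.
move=> p q r; rewrite -[p]cosetg_reprK -[q]cosetg_reprK -[r]cosetg_reprK.
by rewrite !quotg_mul_coset mulgA.
Qed.
Fact quotg_mul1 : left_id (cosetg 1) quotg_mul.
Proof. by move=> p; rewrite -[p]cosetg_reprK quotg_mul_coset mul1g. Qed.
Fact quotg_mulr1 : right_id (cosetg 1) quotg_mul.
Proof. by move=> p; rewrite -[p]cosetg_reprK quotg_mul_coset mulg1. Qed.
Fact quotg_mulV : left_inverse (cosetg 1) quotg_inv quotg_mul.
Proof.
by move=> p; rewrite -[p]cosetg_reprK quotg_inv_coset quotg_mul_coset mulVg.
Qed.
Fact quotg_mulrV : right_inverse (cosetg 1) quotg_inv quotg_mul.
Proof.
by move=> p; rewrite -[p]cosetg_reprK quotg_inv_coset quotg_mul_coset mulgV.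
Qed.

HB.instance Definition _ := isGroup.Build quotg
  quotg_mulA quotg_mul1 quotg_mulr1 quotg_mulV quotg_mulrV.

Lemma cosetg_is_multiplicative : {morph cosetg : x y / x * y}.
Proof. by move=> x y; rewrite [RHS]quotg_mul_coset. Qed.
HB.instance Definition _ :=
  isMultiplicative.Build G quotg cosetg cosetg_is_multiplicative.

HB.instance Definition _ := hasNbhs.Build quotg principal_filter.
HB.instance Definition _ := Discrete_ofNbhs.Build quotg erefl.

Fact quotg_mul_continuous : continuous (fun x : quotg * quotg => x.1 * x.2).
Proof.
move=> [p q] U /nbhs_singleton Upq.
exists ([set p], [set q]) => /=; first by split; exact: discrete_set1.
by move=> _ [/= -> ->].
Qed.

Fact quotg_inv_continuous : continuous (fun x : quotg => x^-1).
Proof. by apply/continuousP => U _; exact: discrete_open. Qed.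

HB.instance Definition _ := isTopologicalGroup.Build quotg
  quotg_mul_continuous quotg_inv_continuous.

Fact quotg_finite : finite_set [set: quotg].
Proof.
have := fin_finite_index N.
move=> /(finite_image (fun C : set G => cosetg (xget 1 C))).
apply: sub_finite_set => q _; exists [set y | fin_set N ((cosetg_repr q)^-1 * y)].
  by exists (cosetg_repr q).
rewrite -[RHS]cosetg_reprK; apply/esym/cosetgP.
set C := [set y | _]; have : C (xget 1 C).
  by apply: xgetPex; exists (cosetg_repr q); rewrite /C /= mulVg;
    case: (fin_subgroup N).
by [].
Qed.

Fact quotg_compact : compact [set: quotg].
Proof. exact/finite_compact/quotg_finite. Qed.

Fact quotg_hausdorff : hausdorff_space quotg.
Proof. exact: discrete_hausdorff. Qed.

Fact quotg_totally_disconnected : totally_disconnected [set: quotg].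
Proof.
exact/zero_dimension_totally_disconnected/discrete_zero_dimension.
Qed.

HB.instance Definition _ := isProfinite.Build quotg
  quotg_compact quotg_hausdorff quotg_totally_disconnected.

End Quotient.

Section ProfiniteCompletion.
Variable G : groupType.

Definition quotg_map (N M : finIndexNormal G) (q : quotg N) : quotg M :=
  cosetg M (cosetg_repr q).

Lemma quotg_map_coset (N M : finIndexNormal G) (x : G) :
  N `<=` M -> quotg_map M (cosetg N x) = cosetg M x.
Proof.
by move=> NM; apply/cosetgP/NM/cosetgP; rewrite cosetg_reprK.
Qed.

Lemma quotg_mapM (N M : finIndexNormal G) : N `<=` M ->
  {morph @quotg_map N M : p q / p * q}.
Proof.
move=> NM p q; rewrite -[p]cosetg_reprK -[q]cosetg_reprK -gmulfM.
by rewrite !(quotg_map_coset _ NM) gmulfM.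
Qed.

Lemma quotg_mapV (N M : finIndexNormal G) : N `<=` M ->
  {morph @quotg_map N M : p / p^-1}.
Proof.
move=> NM p; rewrite -[p]cosetg_reprK [_^-1]quotg_inv_coset.
by rewrite !(quotg_map_coset _ NM) [RHS]quotg_inv_coset.
Qed.

(* The inverse limit of the finite quotients G / N, as the compatible families
   in their product. *)
Definition pcompl_set : set (prod_group (@quotg G)) :=
  [set x | forall N M : finIndexNormal G, N `<=` M -> quotg_map M (x N) = x M].

Fact pcompl_closed : closed pcompl_set.
Proof.
move=> x clx N M NM.
have nbh L : nbhs x [set y | y L = x L].
  have /= := @prod_group_proj_continuous _ (@quotg G) L x [set x L].
  by apply; exact: discrete_set1.
have [y [/(_ N M NM) + [/= yN yM]]] := clx _ (filterI (nbh N) (nbh M)).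
by rewrite yN yM.
Qed.

Fact pcompl_subgroup : subgroup pcompl_set.
Proof.
split=> [|x y xP yP|x xP] N M NM.
- exact: quotg_map_coset.
- by rewrite -[RHS]/(x M * y M) -(xP _ _ NM) -(yP _ _ NM) -quotg_mapM.
- by rewrite -[RHS]/((x M)^-1) -(xP _ _ NM) -quotg_mapV.
Qed.

Definition pcompl_csubgroup := ClosedSubgroup pcompl_closed pcompl_subgroup.
Definition pcompl : Type := csubgroup_type pcompl_csubgroup.
HB.instance Definition _ := ProfiniteGroup.on pcompl.

Definition pcompl_at (x : pcompl) (N : finIndexNormal G) : quotg N :=
  csubgroup_val x N.

Lemma pcompl_ext (x y : pcompl) : pcompl_at x = pcompl_at y -> x = y.
Proof. by move=> xy; apply: csubgroup_val_inj; exact: xy. Qed.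

Lemma pcompl_at_map (x : pcompl) (N M : finIndexNormal G) :
  N `<=` M -> quotg_map M (pcompl_at x N) = pcompl_at x M.
Proof. exact: (csubgroup_valP x). Qed.

Lemma pcompl_atM (x y : pcompl) (N : finIndexNormal G) :
  pcompl_at (x * y) N = pcompl_at x N * pcompl_at y N.
Proof. by []. Qed.

Lemma pcompl_eta_subproof (g : G) :
  pcompl_set (fun N : finIndexNormal G => cosetg N g).
Proof. by move=> N M; exact: quotg_map_coset. Qed.

Definition pcompl_eta (g : G) : pcompl :=
  @csubgroup_mk _ pcompl_csubgroup _ (pcompl_eta_subproof g).

Lemma pcompl_eta_is_multiplicative : {morph pcompl_eta : x y / x * y}.
Proof.
move=> x y; apply: pcompl_ext; apply/functional_extensionality_dep => N.
by rewrite pcompl_atM -[LHS]/(cosetg N (x * y)) gmulfM.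
Qed.
HB.instance Definition _ :=
  isMultiplicative.Build G pcompl pcompl_eta pcompl_eta_is_multiplicative.

End ProfiniteCompletion.

Section PullBack.
Variables (G G' : groupType) (f : {multiplicative G -> G'}).

Variable N : finIndexNormal G'.

Fact preim_subgroup : subgroup (f @^-1` N).
Proof.
have [N1 NM NV] := fin_subgroup N.
by split=> [|x y|x] /=; rewrite ?hom1 ?gmulfM ?homV//; [exact: NM | exact: NV].
Qed.

Fact preim_normal x y : (f @^-1` N) x -> (f @^-1` N) (x ^ y).
Proof.
by move=> /(fin_normal (f y)); rewrite /= /conjg !gmulfM homV.
Qed.

Fact preim_finite_index : finite_index (f @^-1` N).
Proof.
apply: sub_finite_set (finite_image (preimage f) (fin_finite_index N)).
move=> _ [x _ <-]; exists [set y | fin_set N ((f x)^-1 * y)]; first by exists (f x).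
by apply/seteqP; split=> y /=; rewrite gmulfM homV.
Qed.

Definition fin_preim : finIndexNormal G :=
  FinIndexNormal preim_subgroup preim_normal preim_finite_index.

Definition quotg_hom (q : quotg fin_preim) : quotg N :=
  cosetg N (f (cosetg_repr q)).

Lemma quotg_hom_coset x : quotg_hom (cosetg fin_preim x) = cosetg N (f x).
Proof.
apply/cosetgP; rewrite -homV -gmulfM -[fin_set N _]/(fin_set fin_preim _).
by apply/cosetgP; rewrite cosetg_reprK.
Qed.

End PullBack.

Section ProfiniteCompletionMap.
Variables (G G' : groupType) (f : {multiplicative G -> G'}).

Lemma pcompl_map_subproof (x : pcompl G) :
  @pcompl_set G' (fun N => quotg_hom (pcompl_at x (fin_preim f N))).
Proof.
move=> N M NM; have NM' : fin_preim f N `<=` fin_preim f M by move=> y /NM.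
rewrite -(pcompl_at_map x NM') -[pcompl_at x _]cosetg_reprK.
by rewrite quotg_map_coset// !quotg_hom_coset quotg_map_coset.
Qed.

Definition pcompl_map (x : pcompl G) : pcompl G' :=
  @csubgroup_mk _ (pcompl_csubgroup G') _ (pcompl_map_subproof x).

Lemma pcompl_map_is_multiplicative : {morph pcompl_map : x y / x * y}.
Proof.
move=> x y; apply: pcompl_ext; apply/functional_extensionality_dep => N.
set N' := fin_preim f N; rewrite pcompl_atM.
rewrite -[LHS]/(quotg_hom (pcompl_at (x * y) N')) pcompl_atM.
rewrite -[RHS]/(quotg_hom (pcompl_at x N') * quotg_hom (pcompl_at y N')).
rewrite -[pcompl_at x N']cosetg_reprK -[pcompl_at y N']cosetg_reprK.
by rewrite -gmulfM !quotg_hom_coset !gmulfM.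
Qed.
HB.instance Definition _ := isMultiplicative.Build (pcompl G) (pcompl G')
  pcompl_map pcompl_map_is_multiplicative.

Lemma pcompl_map_continuous : continuous pcompl_map.
Proof.
apply: csubgroup_continuousP; apply: prod_continuousP => N.
have c1 : continuous (fun x : pcompl G => pcompl_at x (fin_preim f N)).
  move=> x; apply: (@continuous_comp _ _ _ (@csubgroup_val _ _)
    (fun y : prod_group (@quotg G) => y (fin_preim f N))).
    exact: csubgroup_val_continuous.
  exact: prod_group_proj_continuous.
have c2 : continuous (@quotg_hom _ _ f N).
  by apply/continuousP => U _; exact: discrete_open.
by move=> x; apply: (continuous_comp (c1 x) (c2 _)).
Qed.
HB.instance Definition _ := isContinuous.Build (pcompl G) (pcompl G')
  pcompl_map pcompl_map_continuous.

Lemma pcompl_map_eta g : pcompl_map (pcompl_eta g) = pcompl_eta (f g).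
Proof.
apply: pcompl_ext; apply/functional_extensionality_dep => N.
exact: quotg_hom_coset.
Qed.

End ProfiniteCompletionMap.

Section Covers.
Variables X Y : profGroupType.
Implicit Type f : {conthom X -> Y}.

Lemma ker_closed f : closed [set x | f x = 1].
Proof.
have := @cts_fun _ _ f => /continuous_closedP /(_ [set 1]); apply.
apply: compact_closed; first exact: profinite_hausdorff.
exact: compact_set1.
Qed.

Lemma ker_subgroup f : subgroup [set x | f x = 1].
Proof.
split=> [|x y /= fx fy|x /= fx]; first exact: hom1.
  by rewrite gmulfM /= fx fy mulg1.
by rewrite homV /= fx invg1.
Qed.

Definition ker_csubgroup f : closedSubgroup X :=
  ClosedSubgroup (@ker_closed f) (@ker_subgroup f).

(* For a universal Frattini cover f : H~ -> H, this is K_H. *)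
Definition conthom_ker f : Type := csubgroup_type (ker_csubgroup f).
HB.instance Definition _ f := ProfiniteGroup.on (conthom_ker f).

Definition frattini_cover f :=
  range f = [set: Y] /\
  forall X0 : closedSubgroup X, X0 = [set: X] :> set X <-> f @` X0 = [set: Y].

End Covers.

Definition projective (X : profGroupType) :=
  forall (A B : profGroupType) (a : {conthom A -> B}) (b : {conthom X -> B}),
    range a = [set: B] -> exists c : {conthom X -> A}, a \o c =1 b.

Definition universal_frattini_cover (X Y : profGroupType)
  (f : {conthom X -> Y}) := frattini_cover f /\ projective X.

(* Main.v *)
Require Import Defs.
From HB Require Import structures.
From mathcomp Require Import all_boot.
From mathcomp Require Import all_classical topology.

Set Implicit Arguments.
Unset Strict Implicit.

Local Open Scope classical_set_scope.

(** Let [p] be the map of completions induced by [G * H -> G] and [s] the one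
    induced by [G -> G * H], so that [p s = 1]. Projectivity of [X] and [Y] lifts
    [p u] to [F : X -> Y] and [s v] to [S : Y -> X]. Then [F S] lies over the
    identity of the completion of [G], so it is onto by the Frattini property;
    being over the identity, it maps the kernel of [v] onto itself, and it does so
    through the kernel of [u]. *)

Section ConthomComp.
Variables (X Y Z : topGroupType) (g : {conthom Y -> Z}) (f : {conthom X -> Y}).

(** The composite is bundled as a continuous homomorphism so that it can be the map lifted in
    [projective], and so that its range is a closed subgroup. *)
Definition conthom_comp (x : X) : Z := g (f x).

Lemma conthom_comp_is_multiplicative :
  {morph conthom_comp : x y / (x * y)%g}.
Proof. by move=> x y; rewrite /conthom_comp !gmulfM. Qed.
HB.instance Definition _ :=
  isMultiplicative.Build X Z conthom_comp conthom_comp_is_multiplicative.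

Lemma conthom_comp_continuous : continuous conthom_comp.
Proof. by move=> x; apply: continuous_comp; exact: cts_fun. Qed.
HB.instance Definition _ :=
  isContinuous.Build X Z conthom_comp conthom_comp_continuous.

End ConthomComp.

Section ConthomImage.
Variables (X Y : profGroupType) (f : {conthom X -> Y}).

Lemma conthom_range_closed : closed (range f).
Proof.
apply: compact_closed; first exact: profinite_hausdorff.
apply: continuous_compact; last exact: profinite_compact.
by apply: continuous_subspaceT; exact: cts_fun.
Qed.

Lemma conthom_range_subgroup : subgroup (range f).
Proof.
split=> [|_ _ [x _ <-] [y _ <-]|_ [x _ <-]].
- by exists 1%g => //; exact: hom1.
- by exists (x * y)%g => //; exact: gmulfM.
- by exists (x^-1)%g => //; exact: homV.
Qed.

Definition conthom_range : closedSubgroup Y :=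
  ClosedSubgroup conthom_range_closed conthom_range_subgroup.

End ConthomImage.

(** The image of [f] is compact, hence a closed subgroup of [Y], and [v] maps it onto [Z]. The
    Frattini condition then forces it to be all of [Y]. *)
Lemma frattini_cover_surj (X Y Z : profGroupType) (v : {conthom Y -> Z})
    (f : {conthom X -> Y}) :
  frattini_cover v -> range (v \o f) = [set: Z] -> range f = [set: Y].
Proof.
by move=> [_ /(_ (conthom_range f)) [_ fr]] vf; apply: fr; rewrite image_comp.
Qed.

Section ConthomKer.
Variables (X Y X' Y' : profGroupType).
Variables (u : {conthom X -> X'}) (v : {conthom Y -> Y'}) (F : {conthom X -> Y}).
Hypothesis ker_uv : forall x, u x = 1%g -> v (F x) = 1%g.

Definition ker_map (x : conthom_ker u) : conthom_ker v :=
  @csubgroup_mk _ (ker_csubgroup v) (F (csubgroup_val x))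
    (ker_uv (csubgroup_valP x)).

Lemma ker_map_is_multiplicative : {morph ker_map : x y / (x * y)%g}.
Proof.
move=> x y; apply: csubgroup_val_inj.
rewrite [RHS]csubgroup_val_multiplicative -[LHS]/(F (csubgroup_val (x * y)%g)).
by rewrite [csubgroup_val (_ * _)%g]csubgroup_val_multiplicative gmulfM.
Qed.
HB.instance Definition _ := isMultiplicative.Build
  (conthom_ker u) (conthom_ker v) ker_map ker_map_is_multiplicative.

Lemma ker_map_continuous : continuous ker_map.
Proof.
apply: csubgroup_continuousP => x.
apply: (@continuous_comp _ _ _ (@csubgroup_val _ _) F).
  exact: csubgroup_val_continuous.
exact: cts_fun.
Qed.
HB.instance Definition _ := isContinuous.Build
  (conthom_ker u) (conthom_ker v) ker_map ker_map_continuous.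

End ConthomKer.

(** The coordinate at [N] of the composite is computed from the coordinate of [x] at the preimage of
    [N] under [p \o i]. This preimage has the same elements as [N]. *)
Lemma pcompl_map_cancel (G G' : groupType) (i : {multiplicative G -> G'})
    (p : {multiplicative G' -> G}) :
  cancel i p -> cancel (pcompl_map i) (pcompl_map p).
Proof.
move=> ip x; apply: pcompl_ext; apply/functional_extensionality_dep => N.
(* [N'] and [N] index different coordinates of the product, so the compatibility of the family [x]
   along the inclusion of [N'] in [N] is what links the two. *)
set N' := fin_preim i (fin_preim p N).
have N'N : N' `<=` N by move=> g; rewrite /N' /= ip.
rewrite -(pcompl_at_map x N'N) -[LHS]/(quotg_hom (quotg_hom (pcompl_at x N'))).
by rewrite [LHS]quotg_hom_coset ip.
Qed.

Lemma fp_inlK (G H : groupType) : cancel (@fp_inl G H) (@fp_fst G H).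
Proof. by move=> x; exact: fp_lift_inl. Qed.

Unset Implicit Arguments.

(** The covers [u] and [v] are arbitrary, since universal Frattini covers are determined only up to
    isomorphism. Naturality means that [f] is the restriction of a lift [F] of the map of
    completions induced by the projection to [G]. *)
Theorem theorem4p4 (G H : groupType) (X Y : profGroupType)
    (u : {conthom X -> pcompl (free_product G H)})
    (v : {conthom Y -> pcompl G}) :
  universal_frattini_cover u -> universal_frattini_cover v ->
  exists (F : {conthom X -> Y}) (f : {conthom conthom_ker u -> conthom_ker v}),
    [/\ v \o F =1 pcompl_map (@fp_fst G H) \o u,
        forall x : conthom_ker u, csubgroup_val (f x) = F (csubgroup_val x)
      & range f = [set: conthom_ker v]].
Proof.
move=> [[u_surj _] projX] [frv projY]; have [v_surj _] := frv.
set p : {conthom _ -> _} := pcompl_map (@fp_fst G H).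
set s : {conthom _ -> _} := pcompl_map (@fp_inl G H).
have sK : cancel s p := pcompl_map_cancel (@fp_inlK G H).
have [F vF] := projX _ _ v (conthom_comp p u) v_surj.
have [S uS] := projY _ _ u (conthom_comp s v) u_surj.
have vFS y : v (F (S y)) = v y.
  by rewrite [LHS]vF -[LHS]/(p (u (S y))) (uS y : u (S y) = s (v y)) sK.
have FS_surj : range (conthom_comp F S) = [set: Y].
  apply: (frattini_cover_surj (v := v)) => //.
  by rewrite -v_surj; apply: eq_imagel => y _; exact: vFS.
have kerF x : u x = 1%g -> v (F x) = 1%g.
  by move=> ux; rewrite [LHS]vF -[LHS]/(p (u x)) ux hom1.
exists F, (ker_map kerF); split=> //.
apply/seteqP; split=> // k _.
(* Any [y] with [F (S y) = k] satisfies [v y = v (F (S y)) = v k = 1], so [u (S y) = s (v y) = 1].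
   Thus [S y] is a preimage of [k] in the kernel of [u]. *)
have [y _ FSy] : range (conthom_comp F S) (csubgroup_val k).
  by rewrite FS_surj.
have vk : v (csubgroup_val k) = 1%g := csubgroup_valP k.
have uSy : u (S y) = 1%g.
  by rewrite [LHS]uS -[LHS]/(s (v y)) -vFS (FSy : F (S y) = _) vk hom1.
exists (@csubgroup_mk _ (ker_csubgroup u) (S y) uSy) => //.
exact: csubgroup_val_inj.
Qed.
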